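(* Let $L,n\ge 1$, let $\mu^\bullet=(\mu^0,\mu^1,\ldots,\mu^{L-1})$ be an $L$-multipartition in which every $\mu^k$ is a single row with $|\mu^k|$ boxes, let $\mu=(\mu_1\ge\mu_2\ge\cdots\ge\mu_L)$ be the partition whose parts are the numbers $|\mu^k|$, and let $\lambda=(\lambda_1,\ldots,\lambda_n)$ be a sequence of nonnegative integers with $\lambda_1+\cdots+\lambda_n=|\mu|$. Then the map $$\Psi:\mathrm{Tab}^L(\mu^\bullet,\lambda)\to \mathrm{RC}(\lambda,\mu)$$ defined by the algorithm given in the context is a statistic preserving bijection; that is, $\Psi$ is a bijection and $\mathrm{inv}(T)=\tilde c(\Psi(T))$ for all $T\in \mathrm{Tab}^L(\mu^\bullet,\lambda)$.
   Context: **Multitableaux.** Partitions are drawn in French convention: row $1$ is the bottom row and is the longest; rows and columns are indexed from $1$; $\nu_i$ denotes the $i$-th part of $\nu$ (zero if $i$ exceeds the number of parts), $\nu\subset\nu'$ denotes containment, $\nu^t$ is the transpose. A Young tableau is a filling by positive integers weakly increasing along rows (left to right) and strictly increasing up columns. An $L$-multitableau of shape $\mu^\bullet$ and weight $\lambda=(\lambda_1,\ldots,\lambda_n)$ is an $L$-tuple $T=(T^0,\ldots,T^{L-1})$ of Young tableaux over $\{1,\ldots,n\}$, $T^k$ of shape $\mu^k$, such that the letter $a$ occurs $\lambda_a$ times in total in $T$, $1\le a\le n$. The set of these is $\mathrm{Tab}^L(\mu^\bullet,\lambda)$. **Inversion statistic.** A cell of $\mu^\bullet$ is a triple $s=(i,j,p)$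 with $0\le p\le L-1$ and $(i,j)$ (row $i$, column $j$) a cell of $\mu^p$. Put $\mathrm{row}(s)=i$, $\mathrm{col}(s)=j$, $\mathrm{diag}(s)=j-i$, $\mathrm{pos}(s)=p$. Write $s\prec s'$ if $\mathrm{diag}(s)<\mathrm{diag}(s')$, or if $\mathrm{diag}(s)=\mathrm{diag}(s')$ and $\mathrm{pos}(s)<\mathrm{pos}(s')$. The standardization of $T$ relabels the $N$ cells of $\mu^\bullet$ by $1,2,\ldots,N$, in order of increasing entry of $T$, cells with equal entries being labeled in $\prec$-increasing order. For a standard multitableau $S$ (entries $1,\ldots,N$ each once), a pair of cells $(s,t)$ is an inversion of $S$ if: (1) $\mathrm{diag}(s)=\mathrm{diag}(t)$ and $\mathrm{pos}(s)<\mathrm{pos}(t)$, or $\mathrm{diag}(s)=\mathrm{diag}(t)-1$ and $\mathrm{pos}(s)>\mathrm{pos}(t)$; (2) $\mathrm{row}(s)\le \mathrm{row}(t)$; (3) $S(t)<S(s)<S(t\!\uparrow)$, where $t\!\uparrow$ is the cell directly above $t$ in the same component and $S(t\!\uparrow)=\infty$ if this cell is not in $\mu^\bullet$. $\mathrm{inv}(S)$ is the number of inversions of $S$, and $\mathrm{inv}(T)$ is defined as $\mathrm{inv}$ of the standardization of $T$. **Rigged configurations (symmetric case).** A configuration is a chain of partitions $\emptyset=\nu^{(0)}\subset\nu^{(1)}\subset\cdots\subset\nu^{(n-1)}\subset\nu^{(n)}$. Set $m_i^{(a)}=\nu_i^{(a)}-\nu_{i+1}^{(a)}$ (the number of columns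 of height $i$ in $\nu^{(a)}$) and $p_i^{(a)}=\nu_i^{(a+1)}-\nu_i^{(a)}$ (vacancy numbers). A rigging $J$ attaches to each column of $\nu^{(a)}$, $1\le a\le n-1$, a quantum number, an integer $j$ with $0\le j\le p_i^{(a)}$ if the column has height $i$; riggings that differ by reordering quantum numbers of columns of the same height in the same $\nu^{(a)}$ are identified. Thus $J$ is a family of multisets $J_i^{(a)}$ of $m_i^{(a)}$ integers in $\{0,\ldots,p_i^{(a)}\}$; $|J_i^{(a)}|$ denotes the sum of the elements of $J_i^{(a)}$. A quantum number equal to $p_i^{(a)}$ is called singular. $\mathrm{RC}(\lambda,\mu)$ is the set of all rigged configurations $(\nu,J)$ with $\nu^{(n)}=\mu^t$ and $|\nu^{(a)}|=\lambda_1+\cdots+\lambda_a$ for $1\le a<n$. Its statistic is $$\tilde c(\nu,J)=\sum_{1\le a<n,\;1\le i\le \mu_1}\nu_{i+1}^{(a)}\bigl(\nu_i^{(a+1)}-\nu_i^{(a)}\bigr)+\sum_{1\le a\le n-1,\;1\le i\le\mu_1}|J_i^{(a)}|.$$ **Algorithm for $\Psi$.** Let $T\in\mathrm{Tab}^L(\mu^\bullet,\lambda)$ and write the single row $T^k$ as $t^k_1\le t^k_2\le\cdots\le t^k_{|\mu^k|}$. 1. Start with the empty rigged configuration (all $\nu^{(a)}=\emptyset$, $0\le a\le n$). 2. Process the letters $t^k_i$ in the order $k=L-1,L-2,\ldots,0$ and, for each $k$, $i=1,2,\ldots,|\mu^k|$. Processing $t=t^k_i$ means: for every $a$ with $t\le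 a<n$, add a box to row $i$ of $\nu^{(a)}$ by replacing one column of height $i-1$ carrying a singular quantum number by a column of height $i$ whose quantum number is singular; for $i=1$ nothing is removed, and a new column of height $1$ with singular quantum number is added. The (unrigged) partition $\nu^{(n)}$ also receives a box in row $i$. All other quantum numbers are left unchanged. ''Singular'' for the removed quantum number means equal to $p_{i-1}^{(a)}$ before the step; for the new one it means equal to $p_i^{(a)}$ after the step. 3. After all letters have been processed, invert all quantum numbers: each quantum number $j$ attached to a column of height $i$ in $\nu^{(a)}$ is replaced by $p_i^{(a)}-j$. The result is $\Psi(T)$. *)

(* Defs.v *)
From HB Require Import structures.
From mathcomp Require Import all_boot all_order all_algebra.
From mathcomp Require Import finmap multiset.
Set Implicit Arguments.
Unset Strict Implicit.
Unset Printing Implicit Defensive.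

Local Open Scope mset_scope.
Local Open Scope nat_scope.

(** * Partitions *)

Definition is_partition (nu : seq nat) : bool := sorted geq nu && (0 \notin nu).

(* Rows are indexed from 1; only used with [0 < i]. *)
Definition part (nu : seq nat) (i : nat) : nat := nth 0 nu i.-1.

(* For a weakly decreasing [nu]; trailing zeros of [nu] do not matter. *)
Definition conj_part (nu : seq nat) : seq nat :=
  [seq count (leq j) nu | j <- iota 1 (head 0 nu)].

(** * Multitableaux *)

(* A tableau is the list of its rows, the bottom (longest) row first. *)
Definition is_tableau (n : nat) (nu : seq nat) (t : seq (seq nat)) : bool :=
  [&& shape t == nu,
      all (sorted leq) t,
      sorted (fun lower upper => all2 ltn (take (size upper) lower) upper) t
    & all (fun a => 1 <= a <= n) (flatten t)].

Definition is_multitableau (L n : nat) (mub : L.-tuple (seq nat))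
    (lambda : n.-tuple nat) (T : L.-tuple (seq (seq nat))) : bool :=
  [forall k : 'I_L, is_tableau n (tnth mub k) (tnth T k)]
  && [forall a : 'I_n, count_mem a.+1 (flatten (flatten T)) == tnth lambda a].

Definition Tab (L n : nat) (mub : L.-tuple (seq nat)) (lambda : n.-tuple nat) :=
  {T : L.-tuple (seq (seq nat)) | is_multitableau mub lambda T}.

(** * Inversion statistic *)

(* (row, column, position); rows and columns from 1, positions from 0. *)
Definition cell : Type := (nat * nat * nat)%type.

Definition row_of (s : cell) : nat := s.1.1.
Definition col_of (s : cell) : nat := s.1.2.
Definition pos_of (s : cell) : nat := s.2.
Definition diag_of (s : cell) : int := ((col_of s)%:Z - (row_of s)%:Z)%R.
Definition up (s : cell) : cell := ((row_of s).+1, col_of s, pos_of s).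

Definition cells (mub : seq (seq nat)) : seq cell :=
  [seq (ij, p) | p <- iota 0 (size mub),
                 ij <- [seq (i, j) | i <- iota 1 (size (nth [::] mub p)),
                                     j <- iota 1 (part (nth [::] mub p) i)]].

Definition cell_lt (s s' : cell) : bool :=
  (diag_of s < diag_of s')%R
  || ((diag_of s == diag_of s') && (pos_of s < pos_of s')).

Definition entry (T : seq (seq (seq nat))) (s : cell) : nat :=
  nth 0 (nth [::] (nth [::] T (pos_of s)) (row_of s).-1) (col_of s).-1.

(* The label of [s] is its position, counted from 1, when the cells are listed
   by increasing entry, equal entries in increasing order for [cell_lt].  The
   cells of a tableau with a given entry form a horizontal strip, so this order
   is total on the cells of a multitableau. *)
Definition standardization (mub : seq (seq nat)) (f : cell -> nat) : cell -> nat :=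
  fun s => (count (fun s' => (f s' < f s) || ((f s' == f s) && cell_lt s' s))
                  (cells mub)).+1.

Definition is_inversion (mub : seq (seq nat)) (S : cell -> nat)
    (st : cell * cell) : bool :=
  let: (s, t) := st in
  [&& ((diag_of s == diag_of t) && (pos_of s < pos_of t))
      || ((diag_of s == diag_of t - 1)%R && (pos_of t < pos_of s)),
      row_of s <= row_of t,
      S t < S s
    & (up t \in cells mub) ==> (S s < S (up t))].

Definition inv_std (mub : seq (seq nat)) (S : cell -> nat) : nat :=
  count (is_inversion mub S) [seq (s, t) | s <- cells mub, t <- cells mub].

Definition inv_stat (T : seq (seq (seq nat))) : nat :=
  let mub := [seq shape t | t <- T] in
  inv_std mub (standardization mub (entry T)).

(** * Rigged configurations *)

(* [rc_nu] lists nu^(0), ..., nu^(n); [rc_J r a i] is the multiset of quantum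
   numbers attached to the columns of height i of nu^(a). *)
Record rigged := Rigged {
  rc_nu : seq (seq nat);
  rc_J : nat -> nat -> {mset int}
}.

Definition nu_at (r : rigged) (a : nat) : seq nat := nth [::] (rc_nu r) a.
Definition nu_part (r : rigged) (a i : nat) : nat := part (nu_at r a) i.

Definition ncols (r : rigged) (a i : nat) : nat := nu_part r a i - nu_part r a i.+1.

Definition vacancy (r : rigged) (a i : nat) : int :=
  ((nu_part r a.+1 i)%:Z - (nu_part r a i)%:Z)%R.

(* The last clause fixes the values of [rc_J] at indices that carry no columns
   with quantum numbers, so that equality in [rigged] is equality of rigged
   configurations. *)
Definition is_RC (n : nat) (lambda : n.-tuple nat) (mu : seq nat) (r : rigged) : Prop :=
  [/\ [/\ size (rc_nu r) = n.+1,
          all is_partition (rc_nu r)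
        & nu_at r 0 = [::]],
      forall a i, a < n -> 0 < i -> nu_part r a i <= nu_part r a.+1 i,
      nu_at r n = conj_part mu /\
      (forall a, 1 <= a < n -> sumn (nu_at r a) = sumn (take a lambda)),
      forall a i, 1 <= a < n -> 0 < i ->
        size (rc_J r a i) = ncols r a i /\
        (forall j, j \in rc_J r a i -> (0 <= j <= vacancy r a i)%R)
    & forall a i, ~~ ((1 <= a < n) && (0 < i)) -> rc_J r a i = mset0].

Definition RC (n : nat) (lambda : n.-tuple nat) (mu : seq nat) :=
  {r : rigged | is_RC lambda mu r}.

Definition ctilde (n : nat) (mu : seq nat) (r : rigged) : int :=
  (\sum_(1 <= a < n) \sum_(1 <= i < (head 0%N mu).+1)
      (nu_part r a i.+1)%:Z * ((nu_part r a.+1 i)%:Z - (nu_part r a i)%:Z)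
   + \sum_(1 <= a < n) \sum_(1 <= i < (head 0%N mu).+1)
      \sum_(j <- rc_J r a i) j)%R.

(** * The algorithm *)

Definition rc_empty (n : nat) : rigged :=
  Rigged (nseq n.+1 [::]) (fun _ _ => mset0).

(* Process the letter [it.2] in position [it.1] of its row.  The result is
   [None] when some column to be lengthened does not exist.  Vacancy numbers
   are taken in [r] for the removed quantum numbers and in the new
   configuration for the added ones. *)
Definition process (n : nat) (it : nat * nat) (r : rigged) : option rigged :=
  let: (i, t) := it in
  let nu' := [seq (if t <= a then incr_nth (nu_at r a) i.-1 else nu_at r a)
             | a <- iota 0 n.+1] in
  let removed a := (rc_J r a i.-1) `\ (vacancy r a i.-1) in
  let added a := vacancy (Rigged nu' (rc_J r)) a i +` rc_J r a i in
  let J' a h :=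
    if t <= a < n then
      if h == i then added a
      else if (1 < i) && (h == i.-1) then removed a
      else rc_J r a h
    else rc_J r a h in
  if all (fun a => (t <= a) ==> ((i == 1) || (vacancy r a i.-1 \in rc_J r a i.-1)))
         (iota 0 n)
  then Some (Rigged nu' J') else None.

Definition invert (r : rigged) : rigged :=
  Rigged (rc_nu r)
    (fun a i => seq_mset [seq (vacancy r a i - j)%R | j <- (rc_J r a i : seq int)]).

(* For a multitableau whose components have at most one row: the pairs
   (i, t^k_i) in the order k = L-1, ..., 0 and i = 1, 2, ... *)
Definition letters (T : seq (seq (seq nat))) : seq (nat * nat) :=
  flatten [seq zip (iota 1 (size w)) w | w <- [seq head [::] t | t <- rev T]].

Definition Psi_alg (n : nat) (T : seq (seq (seq nat))) : option rigged :=
  omap invert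
    (foldl (fun o it => obind (process n it) o) (Some (rc_empty n)) (letters T)).

(* Main.v *)
Require Import Defs.
From mathcomp Require Import all_boot ssrint.
From mathcomp Require Import ssralg ssrnum order zify finmap multiset boolp.

Import GRing.Theory.

Local Open Scope mset_scope.
Local Open Scope nat_scope.

(** Let w be a row and let c a be the number of its letters that are at most a.
    While w is processed, the column of nu^(a) created by the first letter is
    singular after each step, so it may be taken as the column that the next
    letter lengthens.  The total effect is therefore that every nu^(a) receives
    one column of height c a, with a singular quantum number
    ([foldl_process_row]).  The other quantum numbers stay, and the vacancy
    number p_h of nu^(a) grows by one for c a < h <= c (a+1) and is unchanged
    for the other heights.

    Bijectivity.  After the insertion nu^(a) has a singular column of height
    c a but none of a height h with c a < h <= c (a+1).  So c a is the largest
    height <= c (a+1) of a singular column of nu^(a), or 0 if there is none;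
    starting from c n, the length of the row, this recovers c, hence w
    ([add_row_inj]).  Conversely, applied to any rigged configuration whose last
    partition has a column of height c n, the same rule yields columns that can
    be removed ([add_row_surj]).  The point to check is that nu^(a) remains
    contained in nu^(a+1), that is p_h > 0 for c a < h <= c (a+1).  If nu^(a) has
    a column of height h, it is nonsingular and p_h > 0.  If not, p_h is at least
    p_(h+1) plus the number of columns of height h of nu^(a+1); for h = c (a+1)
    this number is positive, and for smaller h one has p_(h+1) > 0 by descending
    induction.  Removing the rows one after the other inverts the algorithm.
    The conditions on the weight correspond because the size of nu^(a) is the
    number of letters that are at most a.  Inverting the quantum numbers is an
    involution.

    Statistics.  Equal entries never form an inversion, so the inversions of a
    multitableau of rows are given by pairs of rows u, v, with u in the smaller
    position: they are the columns i with v_i < u_i and the columns i with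
    u_(i+1) < v_i.  The insertion of u changes the summand of index (a, i) of the
    statistic, computed with the inverted quantum numbers, by
      [c a < i <= c (a+1)] nu_i + [i < c a] p_i
    ([costatistic_add_row]).  Here nu_i and p_i are sums over the rows v inserted
    before u: nu_i counts those with v_i <= a, and p_i those with v_i = a + 1.
    As c a < i <= c (a+1) means u_i = a + 1, and i < c a means u_(i+1) <= a, the
    sum over all (a, i) counts the inversions between u and the rows v
    ([row_inv_heights]). *)

(** * Partitions and columns *)

Lemma is_partitionP nu :
  is_partition nu <->
  (forall i, nth 0 nu i.+1 <= nth 0 nu i) /\ 0 \notin nu.
Proof.
split=> [/andP[/(sortedP 0) s_nu nu0]|[s_nu nu0]].
  split=> // i; have [lt_i|ge_i] := ltnP i.+1 (size nu); first exact: s_nu.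
  by rewrite nth_default.
by apply/andP; split=> //; apply/(sortedP 0) => i _; apply: s_nu.
Qed.

Lemma partition_mono {nu} i j :
  is_partition nu -> i <= j -> nth 0 nu j <= nth 0 nu i.
Proof.
move=> /is_partitionP[s_nu _] /subnKC <-; elim: (j - i) => [|k IHk].
  by rewrite addn0.
by rewrite addnS (leq_trans (s_nu _)).
Qed.

(** The absence of zeros makes the length of a partition visible in its parts. *)
Lemma partition_ext {nu nu'} : is_partition nu -> is_partition nu' ->
  (forall i, nth 0 nu i = nth 0 nu' i) -> nu = nu'.
Proof.
have le_size (x y : seq nat) : is_partition x ->
    (forall i, nth 0 x i = nth 0 y i) -> size x <= size y.
  move=> /andP[_ x0] eq_xy; rewrite leqNgt; apply: contra x0 => lt_yx.
  by rewrite -[0](nth_default 0 (leqnn (size y))) -eq_xy mem_nth.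
move=> p p' eq_nu; apply: (@eq_from_nth _ 0) => //.
by apply/eqP; rewrite eqn_leq !le_size.
Qed.

Lemma conj_part_part mu i : sorted geq mu -> 0 < i ->
  part (conj_part mu) i = count (leq i) mu.
Proof.
move=> s_mu i_gt0; rewrite /part /conj_part.
have [le_i|gt_i] := leqP i (head 0 mu).
  by rewrite (nth_map 0) ?size_iota ?nth_iota ?add1n ?prednK.
rewrite nth_default ?size_map ?size_iota; last by rewrite -ltnS prednK.
apply/esym/eqP; rewrite -leqn0 leqNgt -has_count -all_predC.
case: mu s_mu gt_i => //= m mu; rewrite (path_sortedE (rev_trans leq_trans)).
move=> /andP[/allP le_m _] lt_mi; rewrite -ltnNge lt_mi; apply/allP => x /le_m.
by move=> /= le_xm; rewrite -ltnNge (leq_ltn_trans le_xm).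
Qed.

Lemma conj_part_partition mu : sorted geq mu -> is_partition (conj_part mu).
Proof.
move=> s_mu; apply/is_partitionP; split=> [i|].
  rewrite -[nth _ _ i.+1]/(part _ i.+2) -[nth _ _ i]/(part _ i.+1).
  by rewrite !conj_part_part //; apply: sub_count => x /= /ltnW.
apply/mapP => -[j]; rewrite mem_iota add1n ltnS => /andP[j_gt0 le_j] /esym/eqP.
apply/negP; rewrite -lt0n -has_count; case: mu le_j {s_mu} => [|m mu] /=.
  by rewrite leqNgt j_gt0.
by move=> ->.
Qed.

(** The trailing zeros of a weakly decreasing function are cut off, so that the
    result is a partition. *)
Definition partition_of (f : nat -> nat) m :=
  mkseq f (find (fun i => f i == 0) (iota 0 m)).

Lemma nth_partition_of f m i : (forall i, f i.+1 <= f i) -> f m = 0 ->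
  nth 0 (partition_of f m) i = f i.
Proof.
move=> f_dec fm0; rewrite /partition_of; set k := find _ _.
have f_mono x y : x <= y -> f y <= f x.
  move=> /subnKC <-; elim: (y - x) => [|z IHz]; first by rewrite addn0.
  by rewrite addnS (leq_trans (f_dec _)).
have fk0 : f k = 0.
  have := find_size (fun i => f i == 0) (iota 0 m).
  rewrite -/k size_iota leq_eqVlt => /orP[/eqP -> //|lt_km].
  have := @nth_find _ 0 (fun i => f i == 0) (iota 0 m).
  rewrite has_find size_iota lt_km -/k nth_iota // add0n => /(_ isT) /eqP //.
have [lt_ik|le_ki] := ltnP i k; first by rewrite nth_mkseq.
by rewrite nth_default ?size_mkseq //; have := f_mono _ _ le_ki; lia.
Qed.

Lemma partition_of_partition f m : (forall i, f i.+1 <= f i) -> f m = 0 ->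
  is_partition (partition_of f m).
Proof.
move=> f_dec fm0; apply/is_partitionP; split=> [i|].
  by rewrite !nth_partition_of.
apply/mapP => -[i]; rewrite mem_iota add0n => /andP[_ lt_i] /esym/eqP.
have := before_find 0 lt_i; rewrite nth_iota ?add0n => [-> //|].
by apply: (leq_trans lt_i); rewrite -{2}(size_iota 0 m) find_size.
Qed.

Definition add_column nu c :=
  mkseq (fun i => nth 0 nu i + (i < c)) (maxn (size nu) c).

Lemma nth_add_column nu c i : nth 0 (add_column nu c) i = nth 0 nu i + (i < c).
Proof.
rewrite /add_column; have [lt_i|] := ltnP i (maxn (size nu) c).
  by rewrite nth_mkseq.
move=> le_i; rewrite nth_default ?size_mkseq //.
by move: le_i; rewrite geq_max => /andP[? ?]; rewrite nth_default; lia.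
Qed.

Lemma add_column_partition nu c :
  is_partition nu -> is_partition (add_column nu c).
Proof.
move=> /is_partitionP[s_nu nu0]; apply/is_partitionP; split=> [i|].
  by rewrite !nth_add_column; have := s_nu i; lia.
apply/mapP => -[i]; rewrite mem_iota add0n => /andP[_ lt_i] /esym/eqP.
rewrite addn_eq0 => /andP[nu_i /eqP]; case: ltnP => // le_ci _.
have lt_inu : i < size nu by move: lt_i; rewrite leq_max; lia.
by case/negP: nu0; rewrite -(eqP nu_i) mem_nth.
Qed.

Lemma sumn_nth s m : size s <= m -> sumn s = \sum_(0 <= i < m) nth 0 s i.
Proof.
move=> le_sm; rewrite (big_cat_nat (leq0n _) le_sm) /= [X in _ + X]big_nat_cond.
rewrite [X in _ + X]big1 ?addn0 => [|i /andP[/andP[le_si _] _]].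
  by rewrite sumnE (big_nth 0).
by rewrite nth_default.
Qed.

Lemma sumn_add_column nu c : sumn (add_column nu c) = sumn nu + c.
Proof.
pose m := maxn (size nu) c.
rewrite (@sumn_nth _ m) ?size_mkseq // (@sumn_nth nu m) ?leq_maxl //.
under eq_bigr do rewrite nth_add_column.
rewrite big_split /=; congr (_ + _).
rewrite (big_cat_nat (leq0n _) (leq_maxr (size nu) c)) /= -/m.
rewrite [X in _ + X]big_nat_cond [X in _ + X]big1 ?addn0 => [|i /andP[/andP[]]].
  by rewrite (@eq_big_nat _ _ _ _ _ _ (fun=> 1)) ?sum_nat_const_nat ?muln1 ?subn0 // => i /andP[_ ->].
by rewrite leqNgt => /negbTE ->.
Qed.

(** * Inserting a row adds one column to each partition *)

(** The final height of the column that the row [w] adds to nu^(a). *)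
Definition height (w : seq nat) a := count (fun x => x <= a) w.

Lemma height_homo w a b : a <= b -> height w a <= height w b.
Proof. by move=> le_ab; apply: sub_count => x /= /leq_trans ->. Qed.

Lemma height_size w n : all (fun x => 1 <= x <= n) w -> height w n = size w.
Proof.
by move=> w_n; apply/eqP; rewrite -all_count; apply: sub_all w_n => x /andP[].
Qed.

Lemma height0 w n : all (fun x => 1 <= x <= n) w -> height w 0 = 0.
Proof.
move=> /allP w_n; apply/eqP; rewrite -leqn0 leqNgt -has_count -all_predC.
by apply/allP => x /w_n /andP[x_gt0 _] /=; rewrite -ltnNge.
Qed.

Lemma height_rcons w t a : height (rcons w t) a = height w a + (t <= a).
Proof. by rewrite /height -cats1 count_cat /= addn0. Qed.

(** The new quantum number is singular for the new vacancy numbers, hence the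
    vacancy is taken in the configuration with the partitions [nu']. *)
Definition add_row n (c : nat -> nat) (r : rigged) : rigged :=
  let nu' := mkseq (fun a => add_column (nu_at r a) (c a)) n.+1 in
  Rigged nu' (fun a h =>
    if [&& 0 < a < n, 0 < h & h == c a]
    then vacancy (Rigged nu' (rc_J r)) a h +` rc_J r a h else rc_J r a h).

Arguments add_row : simpl never.

Lemma nu_at_add_row n c r a : a <= n ->
  nu_at (add_row n c r) a = add_column (nu_at r a) (c a).
Proof. by move=> le_an; rewrite /nu_at nth_mkseq. Qed.

Lemma nu_part_add_row n c r a i : a <= n -> 0 < i ->
  nu_part (add_row n c r) a i = nu_part r a i + (i <= c a).
Proof.
by move=> le_an i_gt0; rewrite /nu_part nu_at_add_row // /part nth_add_column prednK.
Qed.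

Lemma vacancy_add_row n c r a i : a < n -> 0 < i -> (vacancy (add_row n c r) a i =
  vacancy r a i + (i <= c a.+1)%:Z - (i <= c a)%:Z)%R.
Proof.
by move=> lt_an i_gt0; rewrite /vacancy !nu_part_add_row ?(ltnW lt_an) //; lia.
Qed.

Lemma rc_J_add_row n c r a h :
  rc_J (add_row n c r) a h =
  if [&& 0 < a < n, 0 < h & h == c a]
  then vacancy (add_row n c r) a h +` rc_J r a h else rc_J r a h.
Proof. by []. Qed.

Lemma incr_nth_add_column nu c :
  incr_nth (add_column nu c) c = add_column nu c.+1.
Proof.
apply: (@eq_from_nth _ 0) => [|i _].
  by rewrite size_incr_nth !size_mkseq; case: ifP; lia.
by rewrite nth_incr_nth !nth_add_column; lia.
Qed.

Lemma add_row_nil n r : size (rc_nu r) = n.+1 -> add_row n (height [::]) r = r.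
Proof.
case: r => nu J /= size_nu; rewrite /add_row /=; congr Rigged.
  rewrite -[RHS](mkseq_nth [::]) size_nu; apply: eq_mkseq => a /=.
  apply: (@eq_from_nth _ 0) => [|i _]; first by rewrite size_mkseq maxn0.
  by rewrite nth_add_column addn0.
apply/funext => a; apply/funext => h; rewrite /height /=.
by case: ifP => // /and3P[_ h_gt0 /eqP h0]; rewrite h0 in h_gt0.
Qed.

(** For [a >= t] all letters of [w] are at most [a], so that the column added to
    nu^(a) by [w] has height [size w] and is singular: it is the column that the
    letter [t] lengthens. *)
Lemma process_add_row n w t r :
  sorted leq (rcons w t) -> all (fun x => 1 <= x <= n) (rcons w t) ->
  process n ((size w).+1, t) (add_row n (height w) r) =
  Some (add_row n (height (rcons w t)) r).
Proof.
move=> s_w; rewrite all_rcons => /andP[/andP[t_gt0 le_tn] _].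
set c := height w; set c' := height (rcons w t);
have c'E a : c' a = c a + (t <= a) by exact: height_rcons.
have c_size a : t <= a -> c a = size w.
  move=> le_ta; apply/eqP; rewrite -all_count; move: s_w.
  rewrite (sorted_pairwise leq_trans) pairwise_rcons => /andP[/allP le_wt _].
  by apply/allP => x /le_wt /= /leq_trans ->.
have c_le a : c a <= size w by exact: count_size.
rewrite /process -[(size w).+1.-1]/(size w) ifT; last first.
  apply/allP => a; rewrite mem_iota add0n => /andP[_ lt_an]; apply/implyP.
  move=> le_ta; have [-> //|w_gt0] := posnP (size w).
  by rewrite rc_J_add_row (leq_trans t_gt0) // lt_an w_gt0 c_size // eqxx in_mset1D eqxx orbT.
congr Some.
have eq_nu : [seq (if t <= a then incr_nth (nu_at (add_row n c r) a) (size w)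
                   else nu_at (add_row n c r) a)
             | a <- iota 0 n.+1] = rc_nu (add_row n c' r).
  rewrite [RHS]/(mkseq _ _); apply/eq_in_map => a.
  rewrite mem_iota ltnS => /andP[_ le_an].
  rewrite nu_at_add_row // c'E; case: ifP => le_ta; last by rewrite addn0.
  by rewrite c_size // incr_nth_add_column addn1.
rewrite eq_nu [RHS]/add_row; congr Rigged.
apply/funext => a; apply/funext => h.
case: ifPn => [/andP[le_ta lt_an]|out_a].
  have a_gt0 : 0 < a by apply: leq_trans le_ta.
  rewrite !rc_J_add_row a_gt0 lt_an /= c'E c_size // le_ta addn1.
  have [->|ne_h] := eqVneq h (size w).+1; first by rewrite eqn_leq ltnn.
  rewrite andbF; have [->|ne_h'] := eqVneq h (size w); last by rewrite !andbF.
  rewrite eqxx !andbT ltnS; case: posnP => [//|w_gt0].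
  (* the singular quantum number that [w] has added is taken away again *)
  by rewrite msetD1K.
rewrite rc_J_add_row c'E.
case: (boolP (0 < a < n)) => //= /andP[a_gt0 lt_an].
have lt_at : a < t by rewrite lt_an andbT -ltnNge in out_a.
rewrite [t <= a]leqNgt lt_at addn0; case: ifP => // /andP[h_gt0 /eqP eq_h].
congr (_ +` _).
(* the letter [t] changes row [(size w).+1] only, which lies above row [h] *)
rewrite -[RHS]/(vacancy (add_row n c' r) a h) !vacancy_add_row // !c'E -eq_h.
have le_h : h <= c a.+1 by rewrite eq_h height_homo.
by rewrite leqnn; congr (_ + _%:Z - _)%R; lia.
Qed.

Lemma foldl_process_row n w r : size (rc_nu r) = n.+1 ->
  sorted leq w -> all (fun x => 1 <= x <= n) w ->
  foldl (fun o it => obind (process n it) o) (Some r) (zip (iota 1 (size w)) w) =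
  Some (add_row n (height w) r).
Proof.
move=> size_nu; elim/last_ind: w => [|w t IHw] s_w w_n.
  by rewrite add_row_nil.
rewrite size_rcons -[(size w).+1]addn1 iotaD add1n cats1 zip_rcons ?size_iota //.
rewrite foldl_rcons IHw /=.
- exact: process_add_row.
- by apply: subseq_sorted s_w; [exact: leq_trans|exact: subseq_rcons].
- by move: w_n; rewrite all_rcons => /andP[].
Qed.

(** The state of the algorithm after the rows [W] are processed from the last one
    to the first one, before the quantum numbers are inverted. *)
Definition rc_rows n (W : seq (seq nat)) : rigged :=
  foldr (fun w => add_row n (height w)) (rc_empty n) W.

Definition is_row n (w : seq nat) := sorted leq w && all (fun x => 1 <= x <= n) w.

Lemma size_rc_rows n W : size (rc_nu (rc_rows n W)) = n.+1.
Proof. by case: W => [|w W] /=; rewrite ?size_nseq // size_map size_iota. Qed.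

Lemma Psi_alg_rows n (T : seq (seq (seq nat))) :
  all (is_row n) [seq head [::] t | t <- T] ->
  Psi_alg n T = Some (invert (rc_rows n [seq head [::] t | t <- T])).
Proof.
move=> rowsT; rewrite /Psi_alg /letters map_rev.
set W := [seq _ | t <- T] in rowsT *.
suff -> : foldl (fun o it => obind (process n it) o) (Some (rc_empty n))
    (flatten [seq zip (iota 1 (size w)) w | w <- rev W]) = Some (rc_rows n W) by [].
elim: W rowsT => //= w W IHW /andP[/andP[s_w w_n] rowsW].
rewrite rev_cons map_rcons flatten_rcons foldl_cat IHW //.
by rewrite foldl_process_row // size_rc_rows.
Qed.

(** * Rigged configurations over a list of column heights *)

(** [ms] lists the heights in the order in which the rows are removed.  The sizes
    of the other partitions are left free, which permits an induction on [ms]. *)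
Definition rc_over n (ms : seq nat) (r : rigged) : Prop :=
  [/\ [/\ size (rc_nu r) = n.+1, all is_partition (rc_nu r) & nu_at r 0 = [::]],
      forall a i, a < n -> 0 < i -> nu_part r a i <= nu_part r a.+1 i,
      forall i, 0 < i -> nu_part r n i = count (leq i) ms,
      forall a i, 1 <= a < n -> 0 < i ->
        size (rc_J r a i) = ncols r a i /\
        (forall j, j \in rc_J r a i -> (0 <= j <= vacancy r a i)%R)
    & forall a i, ~~ ((1 <= a < n) && (0 < i)) -> rc_J r a i = mset0].

Lemma is_RC_over n (lambda : n.-tuple nat) mu ms r :
  sorted geq mu -> perm_eq mu ms ->
  is_RC lambda mu r <->
  rc_over n ms r /\ (forall a, 1 <= a < n -> sumn (nu_at r a) = sumn (take a lambda)).
Proof.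
move=> s_mu mu_ms.
split=> [[[size_nu part_nu nu0] le_nu [nu_n sum_nu] J_in J_out]|].
  split=> //; split=> // i i_gt0.
  by rewrite /nu_part nu_n conj_part_part // (permP mu_ms).
case=> -[[size_nu part_nu nu0] le_nu nu_n J_in J_out] sum_nu.
split=> //; split=> //; apply: partition_ext.
- by apply: (allP part_nu); rewrite mem_nth // size_nu.
- exact: conj_part_partition.
move=> i; rewrite -[LHS]/(nu_part r n i.+1) nu_n //.
by rewrite -[RHS]/(part _ i.+1) conj_part_part // (permP mu_ms).
Qed.

Lemma nu_at_partition n ms r a : rc_over n ms r -> is_partition (nu_at r a).
Proof.
case=> -[size_nu part_nu _] _ _ _ _; have [lt_a|ge_a] := ltnP a n.+1.
  by apply: (allP part_nu); rewrite mem_nth // size_nu.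
by rewrite /nu_at nth_default ?size_nu.
Qed.

Lemma nu_part_mono n ms r a i j :
  rc_over n ms r -> i <= j -> nu_part r a j <= nu_part r a i.
Proof.
by move=> r_ok le_ij; apply: partition_mono (nu_at_partition _ _ _ _ r_ok) _; lia.
Qed.

Lemma rc_ext r s : size (rc_nu r) = size (rc_nu s) ->
  (forall a, nu_at r a = nu_at s a) -> (forall a i, rc_J r a i = rc_J s a i) ->
  r = s.
Proof.
case: r s => [nu J] [nu' J'] /= eq_size eq_nu eq_J; congr Rigged.
  by apply: (@eq_from_nth _ [::]) => // a _; apply: eq_nu.
by apply/funext => a; apply/funext => i.
Qed.

Lemma nu_at_empty n a : nu_at (rc_empty n) a = [::].
Proof. by rewrite -[LHS]/(nth [::] (nseq n.+1 [::]) a) nth_nseq if_same. Qed.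

Lemma rc_over_nil n r : rc_over n [::] r <-> r = rc_empty n.
Proof.
split=> [r_ok|->]; last first.
  have nu0 a i : nu_part (rc_empty n) a i = 0.
    by rewrite /nu_part nu_at_empty /part nth_nil.
  split; first split.
  - exact: (size_nseq n.+1).
  - by apply/allP => x /nseqP[->].
  - exact: nu_at_empty.
  - by move=> *; rewrite !nu0.
  - by move=> i i_gt0; rewrite nu0.
  - by move=> a i _ _; rewrite /ncols !nu0 size_mset0; split=> // j; rewrite in_mset0.
  - by [].
have [[size_nu part_nu _] le_nu nu_n J_in J_out] := r_ok.
have nu0 a i : 0 < i -> nu_part r a i = 0.
  move=> i_gt0; have [le_an|gt_an] := leqP a n; last first.
    by rewrite /nu_part /nu_at nth_default ?size_nu // /part nth_nil.
  apply/eqP; rewrite -leqn0 -[0](nu_n i i_gt0).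
  elim: n a le_an {r_ok size_nu part_nu nu_n J_in J_out} le_nu => [|m IHm] a.
    by rewrite leqn0 => /eqP -> _.
  rewrite leq_eqVlt => /orP[/eqP -> //|lt_am] le_nu.
  apply: leq_trans (le_nu _ _ (ltnSn m) i_gt0).
  by apply: IHm => // b j lt_bm j_gt0; apply: le_nu => //; apply: ltnW.
apply: rc_ext => [|a|a i]; first by rewrite size_nu size_nseq.
  apply: partition_ext (nu_at_partition _ _ _ _ r_ok) _ _.
    by rewrite nu_at_empty.
  by move=> i; rewrite -[LHS]/(nu_part r a i.+1) nu0 // nu_at_empty nth_nil.
have [in_ai|] := boolP ((1 <= a < n) && (0 < i)); last exact: J_out.
have /andP[an i_gt0] := in_ai; have [size_J _] := J_in a i an i_gt0.
by apply/eqP; rewrite -size_mset_eq0 size_J /ncols !nu0.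
Qed.

Lemma perm_mset1D (K : choiceType) (x : K) (A : {mset K}) :
  perm_eq (x +` A) (x :: A).
Proof.
by apply/allP => y _; rewrite /= !count_mem_mset mset1DE (eq_sym y).
Qed.

Lemma perm_invert r a i :
  perm_eq (rc_J (invert r) a i) [seq (vacancy r a i - j)%R | j <- rc_J r a i].
Proof. exact: perm_eq_seq_mset. Qed.

Lemma invertK : involutive invert.
Proof.
move=> r; apply: rc_ext => // a i; rewrite -[RHS]seq_mset_id.
apply/eq_seq_msetP; have := perm_map (fun j => vacancy r a i - j)%R (perm_invert r a i).
move=> /perm_trans; apply; rewrite -map_comp map_id_in // => j _ /=.
by rewrite GRing.opprB GRing.addrC GRing.subrK.
Qed.

Lemma rc_over_invert n ms r : rc_over n ms r -> rc_over n ms (invert r).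
Proof.
case=> nu_ok le_nu nu_n J_in J_out; split=> // a i => [an i_gt0|/J_out J0].
  have [size_J J_le] := J_in a i an i_gt0; split.
    by rewrite (perm_size (perm_invert r a i)) size_map.
  move=> j; rewrite (perm_mem (perm_invert r a i)) => /mapP[k /J_le].
  by rewrite -[vacancy (invert r) a i]/(vacancy r a i) => k_le ->; lia.
apply/eqP; rewrite -size_mset_eq0 (perm_size (perm_invert r a i)) size_map.
by rewrite J0 size_mset0.
Qed.

(** * Adding and removing a row *)

(** Vacancy numbers do not decrease and the new column is singular, so all
    quantum numbers stay in their range. *)
Lemma rc_over_add_row n ms c r : c 0 = 0 -> {homo c : a b / a <= b} ->
  rc_over n ms r -> rc_over n (c n :: ms) (add_row n c r).
Proof.
move=> c0 c_homo r_ok; have [[size_nu part_nu nu0] le_nu nu_n J_in J_out] := r_ok.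
split.
- split; first by rewrite size_map size_iota.
    apply/allP => x /mapP[a _ ->]; apply: add_column_partition.
    exact: nu_at_partition r_ok.
  by rewrite nu_at_add_row // c0 nu0.
- move=> a i lt_an i_gt0; rewrite !nu_part_add_row ?(ltnW lt_an) //.
  by have := c_homo _ _ (leqnSn a); have := le_nu a i lt_an i_gt0; lia.
- by move=> i i_gt0; rewrite nu_part_add_row //= nu_n // addnC.
- move=> a i an i_gt0; have /andP[a_gt0 lt_an] := an.
  have [size_J J_le] := J_in a i an i_gt0.
  rewrite rc_J_add_row an i_gt0 /=.
  rewrite /ncols !nu_part_add_row ?(ltnW lt_an) // vacancy_add_row //.
  have := c_homo _ _ (leqnSn a); have := le_nu a i lt_an i_gt0.
  have := nu_part_mono _ _ _ a _ _ r_ok (leqnSn i).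
  have vacE : vacancy r a i = ((nu_part r a.+1 i)%:Z - (nu_part r a i)%:Z)%R by [].
  rewrite /ncols in size_J.
  case: eqP => [eq_i|ne_i] le1 le2 le3; split.
  + by rewrite (perm_size (perm_mset1D _ _ _)) /= size_J; lia.
  + by move=> j; rewrite in_mset1D => /orP[/eqP ->|/J_le]; lia.
  + by rewrite size_J; lia.
  + by move=> j /J_le; lia.
- move=> a i out; rewrite rc_J_add_row; case: ifP => [/and3P[an i_gt0 _]|_].
    by rewrite an i_gt0 in out.
  exact: J_out.
Qed.

Definition singular (r : rigged) a h := vacancy r a h \in rc_J r a h.

Lemma mset_size_gt0 (K : choiceType) (A : {mset K}) :
  0 < size A <-> exists x, x \in A.
Proof.
split=> [|[x]]; last by rewrite -[x \in A]/(x \in enum_mset A); case: (enum_mset A).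
case EA: (enum_mset A) => [//|x s] _; exists x.
by rewrite -[x \in A]/(x \in enum_mset A) EA mem_head.
Qed.

Lemma singular_add_row n c r a : 0 < a < n -> 0 < c a ->
  singular (add_row n c r) a (c a).
Proof.
by move=> an c_gt0; rewrite /singular rc_J_add_row an c_gt0 eqxx in_mset1D eqxx.
Qed.

(** The vacancy numbers p_h of these heights have just grown by one, while the
    quantum numbers have not changed. *)
Lemma nonsingular_add_row n ms c r a h : rc_over n ms r ->
  0 < a < n -> c a < h <= c a.+1 -> ~~ singular (add_row n c r) a h.
Proof.
move=> r_ok an hc; have h_gt0 : 0 < h by lia.
have [_ _ _ J_in _] := r_ok; have [_ J_le] := J_in a h an h_gt0.
have /andP[_ lt_an] := an.
rewrite /singular rc_J_add_row (_ : (h == c a) = false) ?andbF; last by lia.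
by apply/negP => /J_le; rewrite vacancy_add_row //; lia.
Qed.

(** A column of [d] above [c a] would be singular at a height where an insertion
    with heights [c] leaves no singular column. *)
Lemma add_row_height_le n ms c d r s a : rc_over n ms r ->
  add_row n c r = add_row n d s -> 0 < a < n -> d a <= c a.+1 -> d a <= c a.
Proof.
move=> r_ok eq_rs an le_dc; rewrite leqNgt; apply/negP => lt_cd.
have hc : c a < d a <= c a.+1 by rewrite lt_cd.
case/negP: (nonsingular_add_row _ _ _ _ _ _ r_ok an hc).
by rewrite eq_rs singular_add_row //; apply: leq_trans lt_cd.
Qed.

(** By descending induction on [a], both [c a] and [d a] are the largest height of
    a singular column not above [c a.+1 = d a.+1]. *)
Lemma add_row_inj n ms ms' c d r s :
  rc_over n ms r -> rc_over n ms' s -> c 0 = 0 -> d 0 = 0 ->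
  {homo c : a b / a <= b} -> {homo d : a b / a <= b} -> c n = d n ->
  add_row n c r = add_row n d s -> (forall a, a <= n -> c a = d a) /\ r = s.
Proof.
move=> r_ok s_ok c0 d0 c_homo d_homo eq_n eq_rs.
have eq_cd a : a <= n -> c a = d a.
  move=> /subKn <-; elim: (n - a) => [|k IHk]; first by rewrite subn0.
  have [-> |lt_kn] := posnP (n - k.+1); first by rewrite c0 d0.
  have an : 0 < n - k.+1 < n by lia.
  have eqS : (n - k.+1).+1 = n - k by lia.
  apply/eqP; rewrite eqn_leq; apply/andP; split.
    apply: add_row_height_le s_ok (esym eq_rs) an _.
    by rewrite eqS -IHk c_homo //; lia.
  apply: add_row_height_le r_ok eq_rs an _.
  by rewrite eqS IHk d_homo //; lia.
split=> //; have [[size_r _ _] _ _ _ _] := r_ok.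
have [[size_s _ _] _ _ _ _] := s_ok.
apply: rc_ext => [|a|a i]; first by rewrite size_r size_s.
  apply: partition_ext (nu_at_partition _ _ _ _ r_ok) (nu_at_partition _ _ _ _ s_ok) _.
  move=> i; have [le_an|gt_an] := leqP a n; last first.
    by rewrite /nu_at !(nth_default [::]) ?size_r ?size_s.
  have := congr1 (fun x => nth 0 (nu_at x a) i) eq_rs.
  by rewrite !nu_at_add_row // !nth_add_column eq_cd // => /addIn.
have := congr1 (fun x => rc_J x a i) eq_rs; rewrite !rc_J_add_row.
case: (boolP (0 < a < n)) => //= /andP[_ lt_an]; rewrite -(eq_cd a (ltnW lt_an)).
rewrite eq_rs; case: ifP => // _ /(congr1 (fun A => A `\ vacancy (add_row n d s) a i)).
by rewrite !msetD1K.
Qed.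

Fixpoint last_true (P : pred nat) h :=
  if h is h'.+1 then if P h then h else last_true P h' else 0.

Lemma last_trueP (P : pred nat) h :
  [/\ last_true P h <= h, 0 < last_true P h -> P (last_true P h)
    & forall i, last_true P h < i <= h -> ~~ P i].
Proof.
elim: h => [|h [le_h P_h nP_h]] /=; first by split=> // i; lia.
case: ifPn => [Ph|nPh]; first by split=> // i; lia.
split=> // [|i /andP[lt_i]]; first exact: leqW.
by rewrite leq_eqVlt => /orP[/eqP -> //|lt_ih]; apply: nP_h; rewrite lt_i.
Qed.

(** Undoing an insertion is greedy: nu^(a) loses its highest singular column
    among those not higher than the column lost by nu^(a+1).  The argument [k]
    is n - a. *)
Fixpoint strip_height n r m k :=
  if k is k'.+1 then last_true (singular r (n - k)) (strip_height n r m k') else m.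

Lemma strip_heights n r m : 0 < n -> exists c : nat -> nat,
  [/\ c 0 = 0, {homo c : a b / a <= b}, c n = m,
      forall a, 0 < a < n -> 0 < c a -> singular r a (c a)
    & forall a h, 0 < a < n -> c a < h <= c a.+1 -> ~~ singular r a h].
Proof.
move=> n_gt0; pose c a := if a == 0 then 0 else strip_height n r m (n - a).
have cE a : 0 < a < n -> c a = last_true (singular r a) (c a.+1).
  move=> an; rewrite /c ifF /=; last by lia.
  have -> : n - a = (n - a.+1).+1 by lia.
  by rewrite /=; congr (last_true (singular r _) _); lia.
have cP a := last_trueP (singular r a) (c a.+1).
exists c; split.
- by [].
- apply: (homo_leq leqnn leq_trans) => a.
  have [-> //|a_gt0] := posnP a.
  have [lt_an|ge_an] := ltnP a n.
    by rewrite cE ?a_gt0 //; have [] := cP a.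
  rewrite /c ifF /=; last by lia.
  by have [-> ->] : n - a = 0 /\ n - a.+1 = 0 by lia.
- by rewrite /c ifF ?subnn //; lia.
- by move=> a an; rewrite cE //; have [] := cP a.
- by move=> a h an; rewrite {1}cE //; have [_ _] := cP a; apply.
Qed.

(** The heights found by the greedy rule can always be removed: each of them is
    the height of a column, and the containments survive because the vacancy
    numbers that decrease are positive ([room] below). *)
Lemma add_row_surj n m ms R : 0 < n -> rc_over n (m :: ms) R ->
  exists (c : nat -> nat) r,
    [/\ c 0 = 0, {homo c : a b / a <= b}, c n = m, rc_over n ms r
      & R = add_row n c r].
Proof.
move=> n_gt0 R_ok; have [[size_nu part_nu nu0] le_nu nu_n J_in J_out] := R_ok.
have [c [c0 c_homo cn c_sing c_nsing]] := strip_heights n R m n_gt0.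
have cS a : c a <= c a.+1 by apply: c_homo.
have nu_dec a i := nu_part_mono _ _ _ a _ _ R_ok (leqnSn i).
(* the column to be removed from nu^(a) exists *)
have drop a i : a <= n -> 0 < i -> i = c a -> nu_part R a i.+1 < nu_part R a i.
  move=> le_an i_gt0 eq_i; have [an|out] := boolP (0 < a < n).
    have [size_J _] := J_in a i an i_gt0; rewrite -subn_gt0 -/(ncols R a i) -size_J.
    by apply/mset_size_gt0; exists (vacancy R a i); rewrite eq_i; apply: c_sing; rewrite -?eq_i.
  have [a0|a_gt0] := posnP a; first by rewrite eq_i a0 c0 in i_gt0.
  have eq_a : a = n by lia.
  have eq_m : m = i by rewrite eq_i eq_a cn.
  rewrite eq_a !nu_n //= eq_m leqnn ltnn add1n add0n ltnS.
  by apply: sub_count => x /= /ltnW.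
have nu_pos a i : a <= n -> 0 < i <= c a -> 0 < nu_part R a i.
  move=> le_an /andP[i_gt0 le_i].
  apply: leq_trans (nu_part_mono _ _ _ a _ _ R_ok le_i).
  by apply: leq_ltn_trans (drop a (c a) le_an _ erefl); last exact: leq_trans le_i.
(* a column of height [h] is nonsingular, which leaves room below its vacancy
     number *)
have col_room a h : 0 < a < n -> c a < h <= c a.+1 ->
    nu_part R a h <= nu_part R a h.+1 \/ nu_part R a h < nu_part R a.+1 h.
  move=> an hc; have h_gt0 : 0 < h by lia.
  have [size_J J_le] := J_in a h an h_gt0.
  have [] := posnP (size (rc_J R a h)); first by rewrite size_J /ncols; lia.
  move=> /mset_size_gt0[j j_in]; right.
  have ne_j : j != vacancy R a h.
    by apply: contraNneq (c_nsing a h an hc) => eq_j; rewrite /singular -eq_j.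
  by have := J_le j j_in; move: ne_j; rewrite /vacancy; lia.
(* without a column of height [h] in nu^(a), room is inherited from height [h.+1]
     or, for [h = c a.+1], comes from the column that nu^(a+1) loses *)
have room a h : 0 < a < n -> c a < h <= c a.+1 -> nu_part R a h < nu_part R a.+1 h.
  move=> an; have /andP[_ lt_an] := an.
  have [k] := ubnP (c a.+1 - h); elim: k h => // k IHk h lt_k hc.
  have h_gt0 : 0 < h by lia.
  case: (col_room a h an hc) => // no_col.
  have [eq_h|ne_h] := eqVneq h (c a.+1).
    have := drop a.+1 h lt_an h_gt0 eq_h; have := le_nu a h.+1 lt_an isT; lia.
  have := IHk h.+1; have := nu_dec a.+1 h; lia.
pose f a i := nth 0 (nu_at R a) i - (i < c a).
have f_dec a : a <= n -> forall i, f a i.+1 <= f a i.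
  move=> le_an i; rewrite /f; have := nu_dec a i.+1; have := drop a i.+1 le_an isT.
  rewrite /nu_part /part /=; lia.
have f_size a : f a (size (nu_at R a)) = 0 by rewrite /f nth_default.
pose nu := mkseq (fun a => partition_of (f a) (size (nu_at R a))) n.+1.
pose J a h := if [&& 0 < a < n, 0 < h & h == c a]
  then rc_J R a h `\ vacancy R a h else rc_J R a h.
pose r := Rigged nu J.
have nu_r a : a <= n -> nu_at r a = partition_of (f a) (size (nu_at R a)).
  by move=> le_an; rewrite /nu_at nth_mkseq.
have nu_part_r a i : a <= n -> 0 < i -> nu_part r a i = nu_part R a i - (i <= c a).
  move=> le_an i_gt0; rewrite /nu_part nu_r // /part nth_partition_of // /f ?prednK //.
  exact: f_dec.
have eq_nu a : a <= n -> nu_at (add_row n c r) a = nu_at R a.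
  move=> le_an; rewrite nu_at_add_row // nu_r //.
  apply: partition_ext.
  - by apply/add_column_partition/partition_of_partition => //; apply: f_dec.
  - exact: nu_at_partition R_ok.
  move=> i; rewrite nth_add_column nth_partition_of // /f ?subnK //; last exact: f_dec.
  by case: ltnP => // lt_ic; apply: (nu_pos a i.+1).
exists c, r; split=> //; last first.
  apply: rc_ext => [|a|a i]; first by rewrite size_nu size_map size_iota.
    have [le_an|gt_an] := leqP a n; first by rewrite eq_nu.
    by rewrite /nu_at !(nth_default [::]) ?size_nu ?size_map ?size_iota.
  rewrite rc_J_add_row [rc_J r a i]/(J a i) /J.
  case: (boolP [&& _, _ & _]) => // /and3P[an i_gt0 /eqP eq_i]; have /andP[_ lt_an] := an.
  have -> : vacancy (add_row n c r) a i = vacancy R a i.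
    by rewrite /vacancy /nu_part !eq_nu // ltnW.
  rewrite msetB1K // eq_i; by apply: c_sing; rewrite -?eq_i.
split.
- split; first by rewrite size_map size_iota.
    apply/allP => x /mapP[a]; rewrite mem_iota ltnS => /andP[_ le_an] ->.
    by apply: partition_of_partition => //; apply: f_dec.
  by rewrite nu_r // nu0.
- move=> a i lt_an i_gt0; rewrite !nu_part_r ?(ltnW lt_an) //.
  have [a0|a_gt0] := posnP a; first by rewrite a0 /nu_part nu0 /part nth_nil.
  have := le_nu a i lt_an i_gt0; have := room a i _; rewrite a_gt0 lt_an.
  by have := cS a; lia.
- by move=> i i_gt0; rewrite nu_part_r // nu_n // cn /= addKn.
- move=> a i an i_gt0; have /andP[_ lt_an] := an.
  have [size_J J_le] := J_in a i an i_gt0.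
  rewrite [rc_J r a i]/(J a i) /J an i_gt0 /= /ncols /vacancy !nu_part_r ?(ltnW lt_an) //.
  have := nu_dec a i; have := le_nu a i lt_an i_gt0; have := room a i an.
  have := drop a i (ltnW lt_an) i_gt0.
  have := nu_pos a i (ltnW lt_an); have := nu_pos a i.+1 (ltnW lt_an).
  have := nu_pos a.+1 i lt_an; have := cS a.
  move: size_J J_le; rewrite /ncols /vacancy.
  case: eqP => [eq_i|ne_i] size_J J_le caS pos1 pos3 pos2 dr rm le1 le2; split.
  + have sing : singular R a i by rewrite eq_i; apply: c_sing => //; rewrite -eq_i.
    have := perm_size (perm_mset1D _ (vacancy R a i) (rc_J R a i `\ vacancy R a i)).
    by rewrite msetB1K // size_J /vacancy /=; lia.
  + by move=> j; rewrite in_msetB1 => /andP[_ /J_le]; lia.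
  + by rewrite size_J; lia.
  move=> j j_in; have := J_le j j_in.
  have [lt_ci|le_ic] := ltnP (c a) i; last by lia.
  have [le_i|gt_i] := leqP i (c a.+1); last by lia.
  have hc : c a < i <= c a.+1 by rewrite lt_ci.
  have ne_j : j != vacancy R a i.
    by apply: contraNneq (c_nsing a i an hc) => eq_j; rewrite /singular -eq_j.
  by move: ne_j; rewrite /vacancy; lia.
- move=> a i out; rewrite [rc_J r a i]/(J a i) /J; case: ifP => [/and3P[an i_gt0 _]|_].
    by rewrite an i_gt0 in out.
  exact: J_out.
Qed.

(** * Rigged configurations and lists of rows *)

Lemma heightS w a : height w a.+1 = height w a + count_mem a.+1 w.
Proof. by rewrite /height; elim: w => //= x w ->; lia. Qed.

Lemma height_exists c n : c 0 = 0 -> {homo c : a b / a <= b} ->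
  exists2 w, is_row n w & forall a, a <= n -> height w a = c a.
Proof.
move=> c0 c_homo; elim: n => [|n [w /andP[s_w w_n] w_c]].
  by exists [::] => // a; rewrite leqn0 => /eqP ->.
exists (w ++ nseq (c n.+1 - c n) n.+1).
  rewrite /is_row all_cat all_nseq leqnn orbT andbT; apply/andP; split.
    rewrite sorted_pairwise ?pairwise_cat -?sorted_pairwise //; try exact: leq_trans.
    rewrite s_w /=; apply/andP; split.
      apply/allrelP => x y /(allP w_n) /andP[_ le_xn] /nseqP[-> _].
      exact: leqW.
    rewrite sorted_pairwise; last exact: leq_trans.
    by elim: (c n.+1 - c n) => //= k ->; rewrite all_nseq leqnn orbT.
  by apply: sub_all w_n => x /andP[-> /leqW].
move=> a; rewrite /height count_cat count_nseq -/(height w a) leq_eqVlt.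
case/orP => [/eqP ->|lt_an]; last by rewrite w_c // ltnNge -ltnS lt_an addn0.
rewrite leqnn mul1n heightS w_c // (count_memPn _) ?addn0 ?subnKC ?c_homo //.
by apply/negP => /(allP w_n); rewrite ltnn andbF.
Qed.

Lemma height_inj n w w' : is_row n w -> is_row n w' ->
  (forall a, a <= n -> height w a = height w' a) -> w = w'.
Proof.
move=> /andP[s_w w_n] /andP[s_w' w'_n] eq_ww'.
apply: (sorted_eq leq_trans anti_leq s_w s_w'); apply/allP => x _ /=.
have [/andP[x_gt0 le_xn]|out_x] := boolP (1 <= x <= n).
  have le_x'n : x.-1 <= n by lia.
  have := heightS w x.-1; rewrite prednK // !eq_ww' // -{1}(prednK x_gt0) heightS.
  by rewrite prednK // => /addnI ->.
rewrite !(count_memPn _) //; apply: contra out_x; first exact: (allP w'_n).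
exact: (allP w_n).
Qed.

Lemma eq_add_row n c d r :
  (forall a, a <= n -> c a = d a) -> add_row n c r = add_row n d r.
Proof.
move=> eq_cd; have eq_nu a : nu_at (add_row n c r) a = nu_at (add_row n d r) a.
  have [le_an|gt_an] := leqP a n; first by rewrite !nu_at_add_row // eq_cd.
  by rewrite /nu_at !(nth_default [::]) // size_map size_iota.
apply: rc_ext => // [|a i]; first by rewrite !size_map.
rewrite !rc_J_add_row /vacancy /nu_part !eq_nu.
by case: (boolP (0 < a < n)) => //= /andP[_ /ltnW/eq_cd ->].
Qed.

Lemma rc_over_rows n W : all (is_row n) W -> rc_over n (map size W) (rc_rows n W).
Proof.
elim: W => [_|w W IHW /= /andP[/andP[_ w_n] /IHW W_ok]].
  by apply/rc_over_nil.
rewrite -(height_size _ _ w_n); apply: rc_over_add_row W_ok; last exact: height_homo.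
exact: height0 w_n.
Qed.

Lemma rc_rows_inj n W W' : all (is_row n) W -> all (is_row n) W' ->
  map size W = map size W' -> rc_rows n W = rc_rows n W' -> W = W'.
Proof.
elim: W W' => [|w W IHW] [|w' W'] //= /andP[row_w row_W] /andP[row_w' row_W'].
move=> [eq_sz eq_szs]; have [/andP[_ w_n] /andP[_ w'_n]] := (row_w, row_w').
case/(add_row_inj _ _ _ _ _ _ _ (rc_over_rows _ _ row_W) (rc_over_rows _ _ row_W')).
- exact: height0 w_n.
- exact: height0 w'_n.
- exact: height_homo.
- exact: height_homo.
- by rewrite (height_size _ _ w_n) (height_size _ _ w'_n).
by move=> /(height_inj _ _ _ row_w row_w') -> /IHW ->.
Qed.

Lemma rc_rows_surj n ms R : 0 < n -> rc_over n ms R ->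
  exists W, [/\ all (is_row n) W, map size W = ms & R = rc_rows n W].
Proof.
move=> n_gt0; elim: ms R => [|m ms IHms] R.
  by move=> /rc_over_nil ->; exists [::].
move=> /(add_row_surj _ _ _ _ n_gt0)[c [r [c0 c_homo cn /IHms[W [row_W sz_W ->] ->]]]].
have [w row_w w_c] := height_exists c n c0 c_homo.
exists (w :: W); rewrite /= row_w row_W sz_W; split=> //.
  by rewrite -cn -w_c // (@height_size w n) //; case/andP: row_w.
by apply: eq_add_row => a /w_c.
Qed.

Lemma sumn_rc_rows n W a : a <= n ->
  sumn (nu_at (rc_rows n W) a) = height (flatten W) a.
Proof.
move=> le_an; elim: W => [|w W IHW] /=; first by rewrite nu_at_empty.
by rewrite nu_at_add_row // sumn_add_column IHW /height count_cat addnC.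
Qed.

Lemma nu_part_rc_rows n W a i : a <= n -> 0 < i ->
  nu_part (rc_rows n W) a i = \sum_(w <- W) (i <= height w a).
Proof.
move=> le_an i_gt0; elim: W => [|w W IHW] /=.
  by rewrite big_nil /nu_part nu_at_empty /part nth_nil.
by rewrite nu_part_add_row // IHW big_cons addnC.
Qed.

(** [height s a] is the size of nu^(a), so this matches the weight of a
    multitableau with the sizes of the partitions of a rigged configuration. *)
Lemma height_weight n (lambda : n.-tuple nat) (s : seq nat) :
  all (fun x => 1 <= x <= n) s -> sumn lambda = size s ->
  (forall a, 1 <= a < n -> height s a = sumn (take a lambda)) <->
  (forall a : 'I_n, count_mem a.+1 s = tnth lambda a).
Proof.
move=> s_n sum_la; have take_S (a : 'I_n) :
    sumn (take a.+1 lambda) = sumn (take a lambda) + tnth lambda a.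
  by rewrite (take_nth 0) ?size_tuple // -cats1 sumn_cat /= addn0 (tnth_nth 0).
split=> [eq_a|eq_c a /andP[_ /ltnW]].
  have eq_a' a : a <= n -> height s a = sumn (take a lambda).
    have [-> _|a_gt0] := posnP a; first by rewrite take0 (height0 _ _ s_n).
    rewrite leq_eqVlt => /orP[/eqP ->|lt_an]; last by rewrite eq_a ?a_gt0.
    by rewrite (height_size _ _ s_n) take_oversize ?size_tuple.
  move=> a; have := heightS s a; rewrite !eq_a' ?take_S // 1?ltnW //; lia.
elim: a => [_|a IHa lt_an]; first by rewrite take0 (height0 _ _ s_n).
by rewrite heightS IHa 1?ltnW // (take_S (Ordinal lt_an)) -eq_c.
Qed.

(** * The statistic of a rigged configuration of rows *)

(** The inversions between a row [u] and a row [v] of larger position.  The bound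
    [M], at least the lengths of the rows, is common to all pairs so that the
    sums over columns can be exchanged with the sums over rows. *)
Definition row_inv M (u v : seq nat) : nat :=
  \sum_(1 <= i < M.+1)
    ([&& i <= size u, i <= size v & nth 0 v i.-1 < nth 0 u i.-1] +
     [&& i < size u, i <= size v & nth 0 u i < nth 0 v i.-1]).

Fixpoint rows_inv M (W : seq (seq nat)) : nat :=
  if W is u :: W' then \sum_(v <- W') row_inv M u v + rows_inv M W' else 0.

(** In a sorted row the letters [<= a] come first. *)
Lemma leq_height w a i : sorted leq w -> 0 < i ->
  (i <= height w a) = (i <= size w) && (nth 0 w i.-1 <= a).
Proof.
move=> s_w; case: i => // i _; rewrite /height /=.
elim: w s_w i => //= x w IHw p_w i.
have [le_xa|lt_ax] /= := leqP x a.
  by case: i => [|i]; rewrite //= add1n ltnS IHw ?(path_sorted p_w).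
have x_w : all (leq x) w by apply: order_path_min p_w; exact: leq_trans.
have -> : count (fun y => y <= a) w = 0.
  apply/eqP; rewrite -leqn0 leqNgt -has_count -all_predC.
  by apply: sub_all x_w => y /= le_xy; rewrite -ltnNge (leq_trans lt_ax).
rewrite ltn0; case: ltnP => //= lt_i; apply/esym/negbTE; rewrite -ltnNge.
case: i lt_i => //= i lt_i; apply: leq_trans lt_ax _.
by apply: (allP x_w); rewrite mem_nth.
Qed.

Lemma sum_eqS n x (P : pred nat) :
  \sum_(1 <= a < n) ((x == a.+1) && P a) = (1 < x <= n) && P x.-1.
Proof.
elim: n => [|[|n] IHn]; try by rewrite big_geq //; lia.
rewrite big_nat_recr //= IHn.
have [-> /=|ne_x] := eqVneq x n.+2; first by rewrite leqnn ltnn.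
by rewrite addn0; congr (nat_of_bool (_ && _)); lia.
Qed.

(** For a letter x of a row, x = a + 1 means that its column lies above
    [height w a] but not above [height w a.+1]; each inversion is therefore seen
    at exactly one [a], namely one less than its larger letter. *)
Lemma row_inv_heights n M u v : is_row n u -> is_row n v ->
  row_inv M u v = \sum_(1 <= a < n) \sum_(1 <= i < M.+1)
    ((height u a < i <= height u a.+1) && (i <= height v a) +
     (height v a < i <= height v a.+1) && (i < height u a)).
Proof.
move=> /andP[s_u u_n] /andP[s_v v_n]; rewrite exchange_big /=.
apply: eq_big_nat => i /andP[i_gt0 _]; rewrite big_split /=.
have step w : sorted leq w -> forall a, (height w a < i <= height w a.+1) =
    (i <= size w) && (nth 0 w i.-1 == a.+1).
  by move=> s_w a; rewrite ltnNge !leq_height //; case: (i <= size w); lia.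
have entry_n w : all (fun x => 1 <= x <= n) w -> i <= size w ->
    1 <= nth 0 w i.-1 <= n.
  by move=> w_n le_i; apply: (allP w_n); rewrite mem_nth // prednK.
pose x := nth 0 u i.-1; pose y := nth 0 v i.-1.
congr (_ + _); apply/esym.
  transitivity (\sum_(1 <= a < n) ((x == a.+1) && [&& i <= size u, i <= size v & y <= a])).
    apply: eq_bigr => a _; rewrite step // leq_height // -/x -/y.
    by case: (i <= size u); case: (x == _); rewrite ?andbF.
  rewrite sum_eqS; congr nat_of_bool.
  have := entry_n u u_n; have := entry_n v v_n; rewrite -/x -/y.
  case: (i <= size v) => [/(_ isT) y_n|_]; case: (i <= size u) => [/(_ isT)|_] //=;
    rewrite ?andbF //.
  by move: y_n; lia.
transitivity (\sum_(1 <= a < n) ((y == a.+1) && [&& i < size u, i <= size v & nth 0 u i <= a])).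
  apply: eq_bigr => a _; rewrite step // leq_height // -/y.
  by case: (i <= size v); case: (y == _); rewrite ?andbF ?andbT.
rewrite sum_eqS; congr nat_of_bool.
have := entry_n v v_n; rewrite -/y; case: (i <= size v); rewrite ?andbF //.
have [lt_iu|] := ltnP i (size u); rewrite ?andbF //= => /(_ isT).
have /= := allP u_n _ (mem_nth 0 lt_iu); move: (nth 0 u i) => z; lia.
Qed.

(** The statistic of the inverted rigged configuration, expressed by the quantum
    numbers that the algorithm handles before the inversion. *)
Definition costatistic n M (r : rigged) : int :=
  (\sum_(1 <= a < n) \sum_(1 <= i < M.+1)
     ((nu_part r a i.+1)%:Z * vacancy r a i
      + \sum_(j <- rc_J r a i) (vacancy r a i - j)))%R.

Lemma ctilde_invert n mu r :
  ctilde n mu (invert r) = costatistic n (head 0 mu) r.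
Proof.
rewrite /ctilde /costatistic -big_split; apply: eq_bigr => a _.
rewrite -big_split; apply: eq_bigr => i _ /=; congr (_ + _)%R.
by rewrite (perm_big _ (perm_invert r a i)) big_map.
Qed.

Lemma costatistic_empty n M : costatistic n M (rc_empty n) = 0%R.
Proof.
rewrite /costatistic big1 // => a _; rewrite big1 // => i _.
by rewrite /nu_part nu_at_empty /part nth_nil mul0r add0r big_mset0.
Qed.

(** The product nu_(i+1) p_i grows by [i < c a] p_i + [c a < i <= c (a+1)] nu_(i+1),
    and each of the nu_i - nu_(i+1) old columns of height i contributes one more
    if c a < i <= c (a+1). *)
Lemma costatistic_add_row n M ms c r : {homo c : a b / a <= b} -> rc_over n ms r ->
  (costatistic n M (add_row n c r) = costatistic n M r +
   \sum_(1 <= a < n) \sum_(1 <= i < M.+1)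
     ((c a < i <= c a.+1)%:Z * (nu_part r a i)%:Z + (i < c a)%:Z * vacancy r a i))%R.
Proof.
move=> c_homo r_ok; have [_ _ _ J_in _] := r_ok.
rewrite /costatistic -big_split; apply: eq_big_nat => a an.
rewrite -big_split; apply: eq_big_nat => i /andP[i_gt0 _] /=.
have /andP[_ lt_an] := an; have [size_J _] := J_in a i an i_gt0.
have nu_i := nu_part_mono _ _ _ a _ _ r_ok (leqnSn i).
have cS := c_homo _ _ (leqnSn a).
set p := vacancy (add_row n c r) a i.
(* a new column is singular and does not contribute *)
have -> : (\sum_(j <- rc_J (add_row n c r) a i) (p - j) =
           \sum_(j <- rc_J r a i) (p - j))%R.
  rewrite rc_J_add_row; case: ifP => // _.
  by rewrite (perm_big _ (perm_mset1D _ _ _)) big_cons /= subrr add0r.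
have pE : p = (vacancy r a i + (c a < i <= c a.+1)%:Z)%R.
  by rewrite /p vacancy_add_row //; lia.
have -> : (\sum_(j <- rc_J r a i) (p - j) = \sum_(j <- rc_J r a i) (vacancy r a i - j)
    + (c a < i <= c a.+1)%:Z * ((nu_part r a i)%:Z - (nu_part r a i.+1)%:Z))%R.
  under eq_bigr do rewrite pE addrAC.
  rewrite big_split /= big_const_seq count_predT iter_addr_0 size_J /ncols -mulr_natr natz.
  by rewrite -subzn.
rewrite nu_part_add_row ?(ltnW lt_an) // pE.
have : ((i < c a)%:Z * (c a < i <= c a.+1)%:Z = 0)%R by lia.
by move: (_ < c a) (_ && _) => b b'; case: b; case: b' => //= _; rewrite ?mul0r ?mul1r; lia.
Qed.

Lemma vacancy_rc_rows n W a i : a < n -> 0 < i ->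
  vacancy (rc_rows n W) a i = Posz (\sum_(w <- W) (height w a < i <= height w a.+1)).
Proof.
move=> lt_an i_gt0; elim: W => [|w W IHW] /=.
  by rewrite /vacancy /nu_part !nu_at_empty /part nth_nil big_nil.
rewrite vacancy_add_row // IHW big_cons.
by have := height_homo w _ _ (leqnSn a); lia.
Qed.

Lemma costatistic_rc_rows n M W : all (is_row n) W ->
  costatistic n M (rc_rows n W) = Posz (rows_inv M W).
Proof.
elim: W => [_|u W IHW /= /andP[row_u row_W]].
  exact: costatistic_empty.
rewrite (costatistic_add_row _ _ _ _ _ (height_homo u) (rc_over_rows _ _ row_W)).
rewrite IHW // PoszD addrC; congr (_ + _)%R.
have -> : \sum_(v <- W) row_inv M u v = \sum_(v <- W) \sum_(1 <= a < n)
    \sum_(1 <= i < M.+1)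
    ((height u a < i <= height u a.+1) && (i <= height v a) +
     (height v a < i <= height v a.+1) && (i < height u a)).
  rewrite !big_seq; apply: eq_bigr => v v_W.
  by apply: row_inv_heights row_u _; apply: (allP row_W).
rewrite [in RHS]exchange_big /= (big_morph Posz PoszD (erefl (Posz 0))).
apply: eq_big_nat => a /andP[_ lt_an].
rewrite [in RHS]exchange_big /= (big_morph Posz PoszD (erefl (Posz 0))).
apply: eq_big_nat => i /andP[i_gt0 _].
rewrite vacancy_rc_rows // nu_part_rc_rows ?(ltnW lt_an) // -!PoszM -PoszD.
congr Posz; rewrite big_split /= !big_distrr /=; congr (_ + _); apply: eq_bigr => v _.
  by rewrite mulnb.
by rewrite mulnb andbC.
Qed.

(** * The inversion statistic of a multitableau of rows *)

Lemma cell_lt_irr s : cell_lt s s = false.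
Proof. by rewrite /cell_lt !ltnn Order.POrderTheory.ltxx andbF. Qed.

Lemma cell_lt_trans : transitive cell_lt.
Proof. by move=> t s u; rewrite /cell_lt; lia. Qed.

(** Both pairs of cells that can form an inversion are increasing for
    [cell_lt], so that equal entries do not create inversions. *)
Lemma standardization_lt mub f s t : t \in cells mub ->
  cell_lt s t -> (standardization mub f t < standardization mub f s) = (f t < f s).
Proof.
move=> t_in lt_st; rewrite /standardization ltnS.
pose key (x y : cell) := (f x < f y) || ((f x == f y) && cell_lt x y).
have key_trans : transitive key.
  move=> y x z; rewrite /key => /orP[lt_xy|/andP[/eqP -> xy]].
    by case/orP=> [|/andP[/eqP <- _]]; rewrite ?lt_xy // => /(ltn_trans lt_xy) ->.
  case/orP=> [-> //|/andP[-> yz]]; by rewrite (cell_lt_trans _ _ _ xy yz) orbT.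
rewrite -[RHS](_ : key t s = _); last first.
  rewrite /key; case: ltngtP => //= _; apply/negP => lt_ts.
  by have := cell_lt_trans _ _ _ lt_ts lt_st; rewrite cell_lt_irr.
have key_irr x : key x x = false by rewrite /key ltnn cell_lt_irr andbF.
have [lt_ts|ge_ts] := boolP (key t s).
  pose P := predU (fun x => key x t) (pred1 t).
  apply: (@leq_trans (count P (cells mub))); last first.
    by apply: sub_count => x /= /orP[xt|/eqP ->] //; exact: key_trans xt lt_ts.
  rewrite -addn1 -[leqRHS](_ : count (fun x => key x t) (cells mub)
    + count (pred1 t) (cells mub) = _).
    by rewrite leq_add2l -has_count has_pred1.
  rewrite -count_predUI (_ : count (predI _ _) _ = 0) ?addn0 //.
  apply/eqP; rewrite -leqn0 leqNgt -has_count -all_predC; apply/allP => x _ /=.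
  by apply/negP => /andP[xt /eqP eq_xt]; rewrite eq_xt key_irr in xt.
apply/negbTE; rewrite -leqNgt; apply: sub_count => x xs; apply: key_trans xs _.
by move: ge_ts; rewrite /key lt_st; case: ltngtP.
Qed.

Definition cell_of (p j : nat) : cell := (1, j, p).

Lemma cells_rows (T : seq (seq (seq nat))) : all (fun t => size t <= 1) T ->
  cells [seq shape t | t <- T] =
  [seq cell_of p j | p <- iota 0 (size T),
                     j <- iota 1 (size (head [::] (nth [::] T p)))].
Proof.
move=> T1; rewrite /cells size_map; congr flatten; apply/eq_in_map => p.
rewrite mem_iota add0n => lt_p; rewrite (nth_map [::]) //.
have := allP T1 _ (mem_nth [::] lt_p); case: (nth [::] T p) => [|w [|]] //= _.
by rewrite cats0 -map_comp.
Qed.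

Lemma entry_cell_of T p j :
  entry T (cell_of p j) = nth 0 (head [::] (nth [::] T p)) j.-1.
Proof. by rewrite /entry /= nth0. Qed.

Lemma mem_cells_rows (T : seq (seq (seq nat))) p j : all (fun t => size t <= 1) T ->
  (cell_of p j \in cells [seq shape t | t <- T]) =
  (p < size T) && (1 <= j <= size (head [::] (nth [::] T p))).
Proof.
move=> T1; rewrite cells_rows //; apply/allpairsPdep/idP => [[q [k []]]|].
  by rewrite !mem_iota => q_in k_in [-> ->]; lia.
by move=> /andP[? ?]; exists p, j; rewrite !mem_iota; split=> //; lia.
Qed.

Lemma is_inversion_rows T p j q k (C := cells [seq shape t | t <- T]) :
  all (fun t => size t <= 1) T -> cell_of p j \in C -> cell_of q k \in C ->
  is_inversion [seq shape t | t <- T]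
    (standardization [seq shape t | t <- T] (entry T)) (cell_of p j, cell_of q k) =
  (((j == k) && (p < q)) || ((j.+1 == k) && (q < p)))
  && (entry T (cell_of q k) < entry T (cell_of p j)).
Proof.
move=> T1 p_in q_in; rewrite /is_inversion.
have -> : (up (cell_of q k) \in cells [seq shape t | t <- T]) = false.
  apply/negP; rewrite cells_rows // => /allpairsPdep[x [y [_ _ []]]] //.
rewrite leqnn /= !andbT.
have -> : (diag_of (cell_of p j) == diag_of (cell_of q k)) = (j == k).
  by rewrite /diag_of /col_of /row_of /=; lia.
have -> : (diag_of (cell_of p j) == diag_of (cell_of q k) - 1)%R = (j.+1 == k).
  by rewrite /diag_of /col_of /row_of /=; lia.
have [adj|//] := boolP (_ || _).
rewrite standardization_lt // /cell_lt /diag_of /col_of /row_of /pos_of /=; move: adj; lia.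
Qed.

Lemma sum_triangle_rows M W :
  \sum_(0 <= p < size W) \sum_(0 <= q < size W)
     (p < q) * row_inv M (nth [::] W p) (nth [::] W q) = rows_inv M W.
Proof.
elim: W => [|u W IHW] /=; first by rewrite big_geq.
rewrite big_nat_recl // big_nat_recl //=; congr (_ + _).
  by rewrite (big_nth [::]); apply: eq_bigr => q _; rewrite mul1n.
by rewrite -IHW; apply: eq_bigr => p _; rewrite big_nat_recl.
Qed.

Lemma sum_iota_widen M m (F : nat -> nat) : m <= M ->
  \sum_(i <- iota 1 m) F i = \sum_(1 <= i < M.+1) (i <= m) * F i.
Proof.
move=> le_mM; rewrite [RHS](big_cat_nat (n := m.+1)) //= [X in _ = _ + X]big_nat_cond.
rewrite [X in _ = _ + X]big1 ?addn0 => [|i /andP[/andP[lt_mi _] _]]; last first.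
  by rewrite leqNgt lt_mi.
rewrite /index_iota subSS subn0 !big_seq; apply: eq_bigr => i.
by rewrite mem_iota add1n ltnS => /andP[_ ->]; rewrite mul1n.
Qed.

Lemma sum_pred1 M k (F : nat -> nat) :
  \sum_(1 <= i < M.+1) (k == i) * F i = (1 <= k <= M) * F k.
Proof.
elim: M => [|M IHM]; first by rewrite big_geq //; case: k.
rewrite big_nat_recr //= IHM.
have [->|ne_k] := eqVneq k M.+1; first by rewrite ltnn leqnn.
by rewrite mul0n addn0; congr (nat_of_bool _ * _); lia.
Qed.

Lemma inv_stat_rows M (T : seq (seq (seq nat))) :
  all (fun t => size t <= 1) T ->
  all (fun w => size w <= M) [seq head [::] t | t <- T] ->
  inv_stat T = rows_inv M [seq head [::] t | t <- T].
Proof.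
move=> T1 TM; set W := [seq _ | t <- T] in TM *.
have nth_W p : nth [::] W p = head [::] (nth [::] T p).
  have [lt_p|ge_p] := ltnP p (size T); first by rewrite (nth_map [::]).
  by rewrite !nth_default // size_map.
have size_W : size W = size T by rewrite size_map.
have W_M p : size (nth [::] W p) <= M.
  have [lt_p|ge_p] := ltnP p (size W); last by rewrite nth_default.
  by apply: (allP TM); rewrite mem_nth.
pose A u v := \sum_(1 <= j < M.+1)
  [&& j <= size u, j <= size v & nth 0 v j.-1 < nth 0 u j.-1].
pose B u v := \sum_(1 <= j < M.+1)
  [&& j < size u, j <= size v & nth 0 u j < nth 0 v j.-1].
have sum_cells F : \sum_(s <- cells [seq shape t | t <- T]) F s =
    \sum_(0 <= p < size W) \sum_(1 <= j < M.+1) (j <= size (nth [::] W p)) * F (cell_of p j).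
  rewrite cells_rows // big_allpairs_dep /= size_W /index_iota subn0.
  by apply: eq_bigr => p _; rewrite -nth_W (sum_iota_widen M).
(* [p] is the position of the cell with the larger entry *)
transitivity (\sum_(0 <= p < size W) \sum_(0 <= q < size W)
   ((p < q) * A (nth [::] W p) (nth [::] W q) + (q < p) * B (nth [::] W q) (nth [::] W p))).
  rewrite /inv_stat /inv_std -sum1_count big_mkcond big_allpairs_dep.
  rewrite sum_cells; apply: eq_big_nat => p /andP[_ lt_p].
  pose X j q k := [&& j <= size (nth [::] W p), k <= size (nth [::] W q)
    & nth 0 (nth [::] W q) k.-1 < nth 0 (nth [::] W p) j.-1].
  transitivity (\sum_(1 <= j < M.+1) \sum_(0 <= q < size W) \sum_(1 <= k < M.+1)
      ((j == k) * ((p < q) * X j q k) + (j.+1 == k) * ((q < p) * X j q k))).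
    apply: eq_big_nat => j /andP[j_gt0 _].
    rewrite sum_cells big_distrr; apply: eq_big_nat => q /andP[_ lt_q].
    rewrite big_distrr; apply: eq_big_nat => k /andP[k_gt0 _]; rewrite /X.
    have [le_j|] := leqP j (size (nth [::] W p)); last by rewrite !muln0.
    have [le_k|] := leqP k (size (nth [::] W q)); last by rewrite !muln0.
    rewrite is_inversion_rows ?mem_cells_rows -?nth_W -?size_W //; try by lia.
    rewrite !entry_cell_of -!nth_W /=; move: (_ < nth _ _ _) => b.
    by case: (ltngtP p q) => _; case: (j == k); case: (j.+1 == k); case: b.
  rewrite exchange_big; apply: eq_big_nat => q _ /=.
  rewrite /A /B !big_distrr -big_split; apply: eq_big_nat => j /andP[j_gt0 le_jM] /=.
  rewrite big_split !sum_pred1 /X /=; have := W_M q.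
  by case: (nth 0 (nth [::] W q) j < _); lia.
have row_invE u v : row_inv M u v = A u v + B u v by rewrite /row_inv big_split.
rewrite -sum_triangle_rows.
under eq_bigr do rewrite big_split; rewrite big_split /=.
rewrite [X in _ + X]exchange_big -big_split; apply: eq_bigr => p _.
by rewrite -big_split; apply: eq_bigr => q _; rewrite row_invE mulnDr.
Qed.

(** * Multitableaux of rows *)

(** An empty component has no rows, while the algorithm reads it as an empty row. *)
Definition row_tab (w : seq nat) := if w is [::] then [::] else [:: w].

Lemma head_row_tab w : head [::] (row_tab w) = w.
Proof. by case: w. Qed.

Lemma is_tableau_row n nu t : is_partition nu -> size nu <= 1 ->
  is_tableau n nu t = [&& t == row_tab (head [::] t), is_row n (head [::] t)
                        & size (head [::] t) == sumn nu].
Proof.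
case: nu => [|m [|//]] p_nu _; rewrite /is_tableau /is_row.
  by case: t => [|[|x w] [|w' t]] //=; rewrite ?andbF.
have m_gt0 : 0 < m by move: p_nu; rewrite /is_partition /= inE lt0n eq_sym.
case: t => [|w [|w' t]]; rewrite /= ?cats0 ?andbT ?addn0.
- by rewrite eq_sym -leqn0 leqNgt m_gt0.
- case: w => [|x w] /=; first by rewrite eqseq_cons eq_sym -leqn0 leqNgt m_gt0.
  by rewrite !eqseq_cons !eqxx !andbT andbC.
by rewrite eqseq_cons andbF; case: w => //= x w; rewrite eqseq_cons andbF.
Qed.

Lemma flatten_row_tab W : flatten (flatten (map row_tab W)) = flatten W.
Proof. by elim: W => //= -[|x w] W <-. Qed.

Lemma is_multitableau_rows L n (mub : L.-tuple (seq nat)) (lambda : n.-tuple nat)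
    (T : L.-tuple (seq (seq nat))) (W := [seq head [::] t | t <- T]) :
  (forall k : 'I_L, is_partition (tnth mub k) /\ size (tnth mub k) <= 1) ->
  is_multitableau mub lambda T <->
  [/\ T = [seq row_tab w | w <- W] :> seq _, all (is_row n) W,
      [seq size w | w <- W] = [seq sumn nu | nu <- mub]
    & forall a : 'I_n, count_mem a.+1 (flatten W) = tnth lambda a].
Proof.
move=> mub1; have size_W : size W = L by rewrite size_map size_tuple.
have nth_W (k : 'I_L) : nth [::] W k = head [::] (tnth T k).
  by rewrite (nth_map [::]) ?size_tuple // -tnth_nth.
have tabE (k : 'I_L) := is_tableau_row n _ (tnth T k) (mub1 k).1 (mub1 k).2.
split=> [/andP[/forallP tabT /forallP wtT]|[TE rowW sizeW wtW]].
  have eqT : T = [seq row_tab w | w <- W] :> seq _.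
    apply: (@eq_from_nth _ [::]); rewrite ?size_map // => i; rewrite size_tuple => lt_i.
    have := tabT (Ordinal lt_i); rewrite tabE => /and3P[/eqP eq_t _ _].
    rewrite (nth_map [::]) ?size_W // (nth_W (Ordinal lt_i)) -eq_t.
    by rewrite (tnth_nth [::]).
  split=> // [||a].
  - apply/(all_nthP [::]) => i; rewrite size_W => lt_i.
    have := tabT (Ordinal lt_i); rewrite tabE => /and3P[_ + _].
    by rewrite -nth_W.
  - apply: (@eq_from_nth _ 0); rewrite ?size_map ?size_tuple // => i lt_i.
    rewrite (nth_map [::]) ?size_W // (nth_map [::]) ?size_tuple //.
    have := tabT (Ordinal lt_i); rewrite tabE => /and3P[_ _ /eqP].
    by rewrite -nth_W /= (tnth_nth [::]).
  by rewrite -(eqP (wtT a)) eqT flatten_row_tab.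
apply/andP; split; apply/forallP => k; last by rewrite TE flatten_row_tab wtW.
rewrite tabE -nth_W; apply/and3P; split.
- by rewrite (tnth_nth [::]) TE (nth_map [::]) ?size_W.
- by apply: (allP rowW); rewrite mem_nth ?size_W.
have := congr1 (fun s => nth 0 s k) sizeW.
by rewrite (nth_map [::]) ?size_W // (nth_map [::]) ?size_tuple // (tnth_nth [::]) => ->.
Qed.

Lemma bijective_of_inj_surj (A B : Type) (f : A -> B) :
  injective f -> (forall y, exists x, f x = y) -> bijective f.
Proof.
move=> f_inj f_surj; exists (fun y => sval (cid (f_surj y))) => x.
  by apply: f_inj; rewrite (svalP (cid (f_surj (f x)))).
exact: (svalP (cid (f_surj x))).
Qed.

Theorem theorem4p1 (L n : nat) (mub : L.-tuple (seq nat)) (mu : L.-tuple nat)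
    (lambda : n.-tuple nat) :
  1 <= L -> 1 <= n ->
  (forall k : 'I_L, is_partition (tnth mub k) /\ size (tnth mub k) <= 1) ->
  sorted geq mu ->
  perm_eq mu [seq sumn nu | nu <- mub] ->
  sumn lambda = sumn mu ->
  exists Psi : Tab mub lambda -> RC lambda mu,
    [/\ forall T : Tab mub lambda, Psi_alg n (sval T) = Some (sval (Psi T)),
        bijective Psi
      & forall T : Tab mub lambda,
          Posz (inv_stat (sval T)) = ctilde n mu (sval (Psi T))].
Proof.
move=> _ n_gt0 mub1 s_mu mu_mub sum_la.
pose ms := [seq sumn nu | nu <- mub].
pose rows (T : seq (seq (seq nat))) := [seq head [::] t | t <- T].
have tabP (T : Tab mub lambda) := (is_multitableau_rows _ _ _ _ (sval T) mub1).1 (svalP T).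
have weightE W : all (is_row n) W -> map size W = ms ->
    (forall a, 1 <= a < n -> sumn (nu_at (rc_rows n W) a) = sumn (take a lambda)) <->
    (forall a : 'I_n, count_mem a.+1 (flatten W) = tnth lambda a).
  move=> row_W sz_W; rewrite -height_weight.
  - split=> eq_a a an; have := eq_a a an; rewrite sumn_rc_rows //; lia.
  - apply/allP => x /flattenP[w w_W x_w].
    by have /andP[_ /allP] := allP row_W _ w_W; apply.
  by rewrite sum_la size_flatten /shape sz_W; apply: perm_sumn.
have RC_T (T : Tab mub lambda) : is_RC lambda mu (invert (rc_rows n (rows (sval T)))).
  have [_ row_W sz_W wt_W] := tabP T.
  apply/(is_RC_over _ _ _ _ _ s_mu mu_mub); split; last exact/weightE.
  by apply: rc_over_invert; rewrite -[X in rc_over _ X _]sz_W; exact: rc_over_rows.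
pose Psi (T : Tab mub lambda) : RC lambda mu := exist _ _ (RC_T T).
exists Psi; split=> [T||T].
- by apply: Psi_alg_rows; have [] := tabP T.
- apply: bijective_of_inj_surj => [T T' /(congr1 sval) /= eq_TT'|[R R_RC]].
    have [T_W row_W sz_W _] := tabP T; have [T'_W row_W' sz_W' _] := tabP T'.
    apply: val_inj; apply: val_inj; rewrite /= T_W T'_W; congr map.
    apply: (rc_rows_inj _ _ _ row_W row_W'); first by rewrite sz_W sz_W'.
    exact: (inv_inj invertK).
  have [R_ok sum_R] := (is_RC_over _ _ _ _ _ s_mu mu_mub).1 R_RC.
  have [W [row_W sz_W R_W]] := rc_rows_surj _ _ _ n_gt0 (rc_over_invert _ _ _ R_ok).
  have size_T : size (map row_tab W) == L.
    by rewrite size_map -(size_map size) sz_W size_map size_tuple.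
  have rowsT : rows (Tuple size_T) = W.
    by rewrite /rows -map_comp map_id_in // => w _; apply: head_row_tab.
  have T_ok : is_multitableau mub lambda (Tuple size_T).
    apply/(is_multitableau_rows _ _ _ _ _ mub1); rewrite -/(rows _) rowsT; split=> //.
    by apply/weightE => // a an; rewrite -R_W; apply: sum_R.
  exists (exist (fun T => is_true (is_multitableau mub lambda T)) _ T_ok); apply: eq_exist.
  by rewrite /= rowsT -R_W invertK.
have [T_W row_W sz_W _] := tabP T.
rewrite /= ctilde_invert costatistic_rc_rows // -inv_stat_rows //.
  by rewrite T_W all_map; apply/allP => -[].
rewrite -(all_map size (fun m => m <= _)) [map size _]sz_W -(perm_all _ mu_mub).
case: (tval mu) s_mu => //= m s; rewrite (path_sortedE (rev_trans leq_trans)).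
by rewrite leqnn => /andP[].
Qed.
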